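(* Let $P_{16}=\{132,312,321\}$ and $a_n=|A_n(P_{16})|$ (with $a_0=1$). Then, as formal power series, $$A(x)=\sum_{n\ge 0}a_nx^n=\frac{3\sqrt{1-4x}-1}{2\sqrt{1-4x}-4x}.$$
   Context: A Ferrers board $F$ with $n$ rows and $n$ columns is drawn in French notation: left- and bottom-justified, row lengths weakly increasing from top to bottom. $\mathcal{F}_n$ is the family of such boards containing the staircase board (i.e. the $i$-th row from the top has at least $i$ cells for every $i$). A transversal of $F$ is a placement of $1$'s in cells of $F$ with exactly one $1$ in each row and column. Columns are numbered left to right and heights bottom to top; $\pi_c$ is the height of the $1$ in column $c$. A transversal contains a pattern $p\in\mathfrak{S}_k$ if there are columns $c_1<\cdots<c_k$ such that $\pi_{c_1}\cdots\pi_{c_k}$ is order-isomorphic to $p$ and all $k^2$ cells in these columns and in the rows of these $1$'s lie in $F$; otherwise it avoids $p$. $A_n(P)$ is the set of pairs $(T,F)$ with $F\in\mathcal{F}_n$ and $T$ a transversal of $F$ avoiding every pattern in $P$. Here $\sqrt{1-4x}$ is the formal power series square root with constant term $1$. Under the standard correspondence, $a_n=|A_n(P)|=|\mathcal{M}_n(P)|$, where $\mathcal{M}_n(P)$ is the set of perfect matchings on $\{1,\dots,2n\}$ avoiding every $p\in P$. Here a matching contains $p\in\mathfrak{S}_3$ if it has three arcs $B_1,B_2,B_3$ with opening (smaller) vertices $o(B_1)<o(B_2)<o(B_3)$, all three opening vertices smaller than all three closing vertices, and $c(B_i)<c(B_j)\iff p_i>p_j$ for the closing vertices (so $123$ is three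 nested arcs and $321$ is three mutually crossing arcs). *)

(* Defs.v *)
From HB Require Import structures.
From mathcomp Require Import all_boot all_order all_algebra.
From mathcomp Require Import boolp.

Set Implicit Arguments.
Unset Strict Implicit.
Unset Printing Implicit Defensive.

Import GRing.Theory.
Local Open Scope ring_scope.

(** * Formal power series with rational coefficients *)

(* A record, so that the pointwise product on [nat -> rat] does not get in the
   way of the Cauchy product. *)
Record fps : Type := Fps { fps_coef :> nat -> rat }.

HB.instance Definition _ := gen_eqMixin fps.
HB.instance Definition _ := gen_choiceMixin fps.

Lemma fpsP (f g : fps) : f =1 g <-> f = g.
Proof.
split=> [|-> //]; case: f g => [f] [g] /= fg.
by congr Fps; apply: funext.
Qed.

Definition fps_zero : fps := Fps (fun=> 0).
Definition fps_one : fps := Fps (fun n => (n == 0%N)%:R).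
Definition fps_opp (f : fps) : fps := Fps (fun n => - f n).
Definition fps_add (f g : fps) : fps := Fps (fun n => f n + g n).
Definition fps_mul (f g : fps) : fps :=
  Fps (fun n => \sum_(i < n.+1) f i * g (n - i)%N).

Fact fps_addA : associative fps_add.
Proof. by move=> f g h; apply/fpsP => n /=; rewrite addrA. Qed.

Fact fps_addC : commutative fps_add.
Proof. by move=> f g; apply/fpsP => n /=; rewrite addrC. Qed.

Fact fps_add0 : left_id fps_zero fps_add.
Proof. by move=> f; apply/fpsP => n /=; rewrite add0r. Qed.

Fact fps_addN : left_inverse fps_zero fps_opp fps_add.
Proof. by move=> f; apply/fpsP => n /=; rewrite addNr. Qed.

HB.instance Definition _ :=
  GRing.isZmodule.Build fps fps_addA fps_addC fps_add0 fps_addN.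

Definition fps_trunc (m : nat) (f : fps) : {poly rat} := \poly_(i < m.+1) f i.

Lemma fps_truncE m (f : fps) i : (i <= m)%N -> (fps_trunc m f)`_i = f i.
Proof. by move=> im; rewrite coef_poly ltnS im. Qed.

Lemma fps_mul_trunc m (f g : fps) i : (i <= m)%N ->
  fps_mul f g i = (fps_trunc m f * fps_trunc m g)`_i.
Proof.
move=> im; rewrite coefM; apply: eq_bigr => j _.
by rewrite !fps_truncE // ?(leq_trans (leq_subr _ _)) // (leq_trans _ im) // -ltnS.
Qed.

Fact fps_mulA : associative fps_mul.
Proof.
move=> f g h; apply/fpsP => n.
transitivity (fps_trunc n f * fps_trunc n g * fps_trunc n h)`_n.
  rewrite -mulrA coefM; apply: eq_bigr => j _.
  by rewrite (@fps_mul_trunc n) ?leq_subr // fps_truncE // -ltnS.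
rewrite coefM; apply: eq_bigr => j _.
by rewrite (@fps_mul_trunc n) ?fps_truncE ?leq_subr // -ltnS.
Qed.

Fact fps_mulC : commutative fps_mul.
Proof. by move=> f g; apply/fpsP => n; rewrite !(@fps_mul_trunc n) // mulrC. Qed.

Fact fps_mul1 : left_id fps_one fps_mul.
Proof.
move=> f; apply/fpsP => n /=; rewrite big_ord_recl /= mul1r subn0.
by rewrite big1 ?addr0 // => i _; rewrite mul0r.
Qed.

Fact fps_mulDl : left_distributive fps_mul fps_add.
Proof.
move=> f g h; apply/fpsP => n /=; rewrite -big_split /=.
by apply: eq_bigr => i _; rewrite mulrDl.
Qed.

Fact fps_one_neq0 : fps_one != 0 :> fps.
Proof. by apply/eqP => /fpsP /(_ 0%N) /eqP; rewrite /= oner_eq0. Qed.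

HB.instance Definition _ := GRing.Zmodule_isComNzRing.Build fps
  fps_mulA fps_mulC fps_mul1 fps_mulDl fps_one_neq0.

Lemma fps0E n : (0 : fps) n = 0. Proof. by []. Qed.
Lemma fps1E n : (1 : fps) n = (n == 0%N)%:R. Proof. by []. Qed.
Lemma fpsDE (f g : fps) n : (f + g) n = f n + g n. Proof. by []. Qed.
Lemma fpsNE (f : fps) n : (- f) n = - f n. Proof. by []. Qed.
Lemma fpsME (f g : fps) n : (f * g) n = \sum_(i < n.+1) f i * g (n - i)%N.
Proof. by []. Qed.

Lemma fpsM0E (f g : fps) : (f * g) 0%N = f 0%N * g 0%N.
Proof. by rewrite fpsME big_ord_recl big_ord0 addr0. Qed.

Lemma fpsMnE (f : fps) k n : (f *+ k) n = f n *+ k.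
Proof. by elim: k => // k IHk; rewrite !mulrS fpsDE IHk. Qed.

Definition fpsX : fps := Fps (fun n => (n == 1%N)%:R).

(* Course-of-values recursion: coefficient [n] is [step n g], where [g] agrees
   with the series being defined on all indices smaller than [n]. *)
Fixpoint fps_approx (step : nat -> (nat -> rat) -> rat) n : nat -> rat :=
  if n is m.+1 then
    fun k => if (k < m)%N then fps_approx step m k else step m (fps_approx step m)
  else fun=> 0.

Definition fps_rec (step : nat -> (nat -> rat) -> rat) : fps :=
  Fps (fun n => fps_approx step n.+1 n).

Lemma fps_recE step :
  (forall n g g', (forall k, (k < n)%N -> g k = g' k) -> step n g = step n g') ->
  forall n, fps_rec step n = step n (fps_rec step).
Proof.
move=> stepP n; rewrite {1}/fps_rec /= ltnn; apply: stepP => k.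
elim: n => // n IHn; rewrite ltnS leq_eqVlt => /predU1P [-> // | kn].
by rewrite -IHn // /= kn.
Qed.

Definition fps_unit : {pred fps} := fun f => f 0%N != 0.

Definition fps_inv_step (f : fps) n (g : nat -> rat) : rat :=
  ((n == 0%N)%:R - \sum_(i < n) g i * f (n - i)%N) / f 0%N.

Definition fps_inv (f : fps) : fps :=
  if f \in fps_unit then fps_rec (fps_inv_step f) else f.

Fact fps_mulVf : {in fps_unit, left_inverse 1 fps_inv *%R}.
Proof.
move=> f fU; apply/fpsP => n; rewrite /fps_inv fU fpsME.
set g := fps_rec _; have gE : g n = fps_inv_step f n g.
  apply: fps_recE => m g1 g2 g12; congr ((_ - _) / _).
  by apply: eq_bigr => i _; rewrite g12.
clearbody g; rewrite big_ord_recr /= subnn gE.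
by rewrite /fps_inv_step divfK // addrC subrK.
Qed.

Fact fps_unitP (f g : fps) : g * f = 1 -> f \in fps_unit.
Proof.
move=> /fpsP /(_ 0%N); rewrite fpsM0E fps1E => gf1.
apply/negP => /eqP f0; move/eqP: gf1.
by rewrite f0 mulr0 eq_sym oner_eq0.
Qed.

Fact fps_inv_out : {in [predC fps_unit], fps_inv =1 id}.
Proof. by move=> f /negbTE fU; rewrite /fps_inv fU. Qed.

HB.instance Definition _ := GRing.ComNzRing_hasMulInverse.Build fps
  fps_mulVf fps_unitP fps_inv_out.

Lemma fps_unitE (f : fps) : (f \is a GRing.unit) = (f 0%N != 0).
Proof. by []. Qed.

Definition fps_sqrt_step (f : fps) n (g : nat -> rat) : rat :=
  if n is m.+1 then (f n - \sum_(i < m) g i.+1 * g (m - i)%N) / 2 else 1.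

(* The square root with constant term 1; meaningful when [f 0 = 1], see
   [fps_sqrtK] and [fps_sqrt_unique]. *)
Definition fps_sqrt (f : fps) : fps := fps_rec (fps_sqrt_step f).

Lemma fps_sqrtE (f : fps) n : fps_sqrt f n = fps_sqrt_step f n (fps_sqrt f).
Proof.
apply: fps_recE => {}n g g' gg'; case: n gg' => //= n gg'.
congr ((_ - _) / _); apply: eq_bigr => i _.
by rewrite !gg' // ltnS // leq_subr.
Qed.

Lemma fps_sqrt0 (f : fps) : fps_sqrt f 0%N = 1.
Proof. by rewrite fps_sqrtE. Qed.

Lemma fps_sqrtK (f : fps) : f 0%N = 1 -> fps_sqrt f ^+ 2 = f.
Proof.
move=> f0; apply/fpsP => n; rewrite expr2 fpsME.
have := fps_sqrtE f n; have := fps_sqrt0 f.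
move: (fps_sqrt f) => g g0 gE.
case: n gE => [|n] gE; first by rewrite big_ord_recl big_ord0 g0 f0 addr0 mulr1.
rewrite big_ord_recl big_ord_recr /= subn0 subnn g0 mul1r mulr1 gE /=.
have -> : \sum_(i < n) g (bump 0 i) * g (n.+1 - bump 0 i)%N =
          \sum_(i < n) g i.+1 * g (n - i)%N by [].
by rewrite addrCA -mulr2n -(mulr_natr (_ / _)) divfK // addrC subrK.
Qed.

Lemma fps_sqrt_unique (f g : fps) : g 0%N = 1 -> g ^+ 2 = f -> g = fps_sqrt f.
Proof.
move=> g0 gf.
have f0 : f 0%N = 1 by rewrite -gf expr2 fpsM0E g0 mulr1.
have U : g + fps_sqrt f \is a GRing.unit by rewrite fps_unitE fpsDE g0 fps_sqrt0.
apply/eqP; rewrite -subr_eq0 -(inj_eq (mulIr U)) mul0r -subr_sqr.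
by rewrite gf fps_sqrtK // subrr.
Qed.

(** * Ferrers boards, transversals and patterns *)

(* A cell is a pair (column, height), both numbered from 0; so the [i]-th row
   from the top, [1 <= i <= n], is the row at height [n - i]. *)
Definition cell (n : nat) : Type := ('I_n * 'I_n)%type.

Definition row_length n (F : {set cell n}) (h : 'I_n) : nat :=
  #|[set c : 'I_n | (c, h) \in F]|.

(* The last condition is the containment of the staircase: the [i]-th row from
   the top has at least [i] cells.  It also forces all [n] rows and all [n]
   columns to be nonempty. *)
Definition is_board n (F : {set cell n}) : bool :=
  [&& [forall c : 'I_n, forall c' : 'I_n, forall h : 'I_n,
         (c' <= c)%N ==> ((c, h) \in F) ==> ((c', h) \in F)],
      [forall c : 'I_n, forall h : 'I_n, forall h' : 'I_n,
         (h' <= h)%N ==> ((c, h) \in F) ==> ((c, h') \in F)],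
      [forall h : 'I_n, forall h' : 'I_n,
         (h' <= h)%N ==> (row_length F h <= row_length F h')%N]
    & [forall h : 'I_n, (n - h <= row_length F h)%N]].

Definition is_transversal n (F T : {set cell n}) : bool :=
  [&& T \subset F,
      [forall c : 'I_n, #|[set h : 'I_n | (c, h) \in T]| == 1%N]
    & [forall h : 'I_n, #|[set c : 'I_n | (c, h) \in T]| == 1%N]].

(* The pattern [p], a permutation of [1..k], is given by its one-line notation;
   [h i] is the height of the 1 of [T] in column [c i]. *)
Definition contains n (F T : {set cell n}) (p : seq nat) : bool :=
  [exists c : {ffun 'I_(size p) -> 'I_n}, exists h : {ffun 'I_(size p) -> 'I_n},
    [&& [forall i : 'I_(size p), forall j : 'I_(size p),
           (i < j)%N ==> (c i < c j)%N],
        [forall i : 'I_(size p), (c i, h i) \in T],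
        [forall i : 'I_(size p), forall j : 'I_(size p),
           (h i < h j)%N == (nth 0%N p i < nth 0%N p j)%N]
      & [forall i : 'I_(size p), forall j : 'I_(size p), (c i, h j) \in F]]].

Definition avoiders n (P : seq (seq nat)) : {set {set cell n} * {set cell n}} :=
  [set TF | [&& is_board TF.2, is_transversal TF.2 TF.1
              & all (fun p => ~~ contains TF.2 TF.1 p) P]].

Definition P16 : seq (seq nat) := [:: [:: 1; 3; 2]; [:: 3; 1; 2]; [:: 3; 2; 1]]%N.

Definition gen_series (a : nat -> nat) : fps := Fps (fun n => (a n)%:R).

(* Main.v *)
Require Import Defs.
From mathcomp Require Import all_boot all_order all_algebra.
From mathcomp Require Import boolp fingroup perm zify ring.

(** A pair (transversal, board) is encoded by the row lengths [r] of the board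
and the permutation [s] sending a height to the column of its 1.

The three patterns of [P16] are the permutations of size 3 in which 3 stands
to the left of 2.  So avoidance says: if three 1's at heights [h3 < h2 < h1]
lie in columns that all meet row [h1], then the 1 of [h1] is to the right of
that of [h2] ([avoids_P16]).  Consider the top row, with [k.+1] cells and its 1
in column [c].  Among the columns before [k.+1], two columns to the right of [c]
would give a forbidden triple whose top 1 is the one of [c].  Hence [c = k], or
[c = k.-1] and the 1 of column [k] is lower than those of all the columns
before it.

This makes the objects recursive under deletion of the top row and of the
column of its 1.  Let [configs n i k] be the set of configurations of size [n]
all of whose rows have at least [k] cells and in which the 1 of column [i] is
lower than those of columns [0..i-1].  For [i = 0] the second condition is
void; [configs n 0 0] is what must be counted.  For [0 < i] the condition
forces every choice: the top 1 is in the last cell of its row while column [i]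
is not the last one, and just before column [i] otherwise.  This gives the
recurrences [card_configs_free], [card_configs_above] and [card_configs_at].

In terms of the series [S i k] of these cardinals, each recurrence is a second
order linear recurrence in [k] with characteristic equation [t = t^2 + X].  Its
roots are [r = (1 - sqrt(1 - 4X)) / 2] and [1 - r].  As [S i k] is divisible by
[X^k] and [1 - r] is invertible, the second root cannot occur
([kernel_method]).  This yields first [S i (i+1) = r^i * S 0 1], then
[sqrt(1 - 4X) * (S 0 2 - r * S 0 1) = X * S 0 1].  Together with
[S 0 1 = S 0 2 + X * S 0 0] and [S 0 0 = 1 + S 0 1], these are linear equations
for [S 0 0]. *)

Set Implicit Arguments.
Unset Strict Implicit.
Unset Printing Implicit Defensive.

Import GRing.Theory Num.Theory.

(** * Configurations and the removal of the top row *)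

Definition config (n : nat) : Type := ({ffun 'I_n -> 'I_n.+1} * 'S_n)%type.

(** Given the other fields, [avoiding_P] is the avoidance of 132, 312 and 321:
see [avoids_P16]. *)
Record avoiding n (x : config n) : Prop := Avoiding {
  avoiding_stair : forall h : 'I_n, n <= x.1 h + h;
  avoiding_mono : forall h h' : 'I_n, h <= h' -> x.1 h' <= x.1 h;
  avoiding_in : forall h : 'I_n, x.2 h < x.1 h;
  avoiding_P : forall h1 h2 h3 : 'I_n, h3 < h2 -> h2 < h1 ->
    x.2 h1 < x.2 h2 -> x.2 h2 < x.1 h1 -> x.1 h1 <= x.2 h3 }.

Definition lowest n i (s : 'S_n) : Prop :=
  forall h h' : 'I_n, s h < i -> s h' = i :> nat -> h' < h.

(** The bound [k <= n] is not automatic: without it the empty configuration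
would be wide for every [k]. *)
Definition wide n k (x : config n) : Prop := k <= n /\ forall h, k <= x.1 h.

Definition configs n i k : {set config n} :=
  [set x : config n | `[< [/\ avoiding x, wide k x & lowest i x.2] >]].

(** Puts a row of [k.+1] cells on top of a board and a new column at position
[c], with the new 1 at their crossing; every old row gains one cell. *)
Definition add_row n k c (x : config n) : config n.+1 :=
  ([ffun h => if unlift ord_max h is Some h' then lift ord0 (x.1 h')
              else lift ord0 k],
   lift_perm ord_max c x.2).

Lemma add_row_inj n k c : injective (@add_row n k c).
Proof.
move=> [r s] [r' s'] [/ffunP rr' /permP ss']; congr pair.
  apply/ffunP => h; have := rr' (lift ord_max h).
  by rewrite !ffunE liftK => /lift_inj.
apply/permP => h; have := ss' (lift ord_max h).
by rewrite !lift_perm_lift => /lift_inj.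
Qed.

Lemma lift_perm_onto n (i : 'I_n.+1) (s : 'S_n.+1) :
  exists t : 'S_n, s = lift_perm i (s i) t.
Proof.
have liftE k : exists j, s (lift i k) = lift (s i) j.
  have [j ->|/perm_inj/eqP] := unliftP (s i) (s (lift i k)); first by exists j.
  by rewrite eq_sym (negbTE (neq_lift i k)).
have f_inj : injective (fun k => sval (cid (liftE k))).
  move=> j k /=; case: (cid _) => a /= sj; case: (cid _) => b /= sk ab.
  by apply/(@lift_inj _ i)/(@perm_inj _ s); rewrite sj sk ab.
exists (perm f_inj); apply/permP => h; have [k ->|->] := unliftP i h.
  by rewrite lift_perm_lift permE; case: (cid _).
by rewrite lift_perm_id.
Qed.

Lemma add_row_onto n (k : 'I_n.+1) (y : config n.+1) :
  (forall h, 0 < y.1 h) -> y.1 ord_max = k.+1 :> nat ->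
  exists x, y = add_row k (y.2 ord_max) x.
Proof.
case: y => r s /= r_gt0 rmax; have [t st] := lift_perm_onto ord_max s.
exists ([ffun h => inord (r (lift ord_max h)).-1], t).
congr pair => //; apply/ffunP => h; apply: val_inj; rewrite ffunE.
have [h' ->|->] := unliftP ord_max h; last by rewrite /= rmax /bump.
rewrite /= ffunE inordK; first by rewrite /bump /= add1n prednK.
by rewrite -ltnS prednK.
Qed.

Lemma add_row1_lift n k c (x : config n) h :
  (add_row k c x).1 (lift ord_max h) = (x.1 h).+1 :> nat.
Proof. by rewrite ffunE liftK. Qed.

Lemma add_row1_max n k c (x : config n) :
  (add_row k c x).1 ord_max = k.+1 :> nat.
Proof. by rewrite ffunE unlift_none. Qed.

Lemma add_row2_lift n k (c : 'I_n.+1) (x : config n) h :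
  (add_row k c x).2 (lift ord_max h) = bump c (x.2 h) :> nat.
Proof. by rewrite lift_perm_lift. Qed.

Lemma add_row2_max n k (c : 'I_n.+1) (x : config n) :
  (add_row k c x).2 ord_max = c.
Proof. exact: lift_perm_id. Qed.

Lemma ltn_bump c a : (c < bump c a) = (c <= a).
Proof. by rewrite /bump; lia. Qed.

Lemma bump_ltnS c a k : c <= k -> (bump c a < k.+1) = (a < k).
Proof. by rewrite /bump; lia. Qed.

Lemma ltn_bumpr c a k : c <= k -> (k < bump c a) = (k <= a).
Proof. by rewrite /bump; lia. Qed.

Lemma ord_max_or_lift n (h : 'I_n.+1) :
  h = ord_max \/ exists g : 'I_n, h = lift ord_max g.
Proof.
by case: (unliftP ord_max h) => [g|] ->; [right; exists g | left].
Qed.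

(** As the old rows have at least [k] cells, inserting column [c <= k] commutes
with every comparison between a column and a row length.  Hence the only new
forbidden triples have the new 1 on top.  Column [a] of the old
board lies to the right of the new one iff [c <= a], and meets the new row iff
[a < k]. *)
Lemma add_row_avoiding n (k c : 'I_n.+1) (x : config n) :
  avoiding (add_row k c x) <->
  [/\ c <= k, avoiding x, wide k x &
    forall h2 h3 : 'I_n, h3 < h2 -> c <= x.2 h2 -> x.2 h2 < k -> k <= x.2 h3].
Proof.
have bE h : bump n (h : 'I_n) = h by rewrite /bump leqNgt ltn_ord.
set y := add_row k c x.
have y1l h : y.1 (lift ord_max h) = (x.1 h).+1 :> nat by exact: add_row1_lift.
have y1m : y.1 ord_max = k.+1 :> nat by exact: add_row1_max.
have y2l h : y.2 (lift ord_max h) = bump c (x.2 h) :> nat.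
  exact: add_row2_lift.
have y2m : y.2 ord_max = c by exact: add_row2_max.
have kn := ltn_ord k; have cn := ltn_ord c.
split=> [[ys ym yi yP]|[ck [xs xm xi xP] [_ kx] cx]]; last first.
  split.
  - move=> h; have [->|[g ->]] := ord_max_or_lift h.
      by rewrite y1m /=; lia.
    by rewrite y1l /= bE addSn ltnS.
  - move=> h h'; have [->|[g ->]] := ord_max_or_lift h;
      have [->|[g' ->]] := ord_max_or_lift h';
      rewrite ?y1l ?y1m //= ?bE ?ltnS //.
    + by have := ltn_ord g'; lia.
    + exact: xm.
  - move=> h; have [->|[g ->]] := ord_max_or_lift h.
      by rewrite y1m y2m ltnS.
    by rewrite y1l y2l bump_ltnS // (leq_trans ck).
  - move=> h1 h2 h3.
    have [->|[g3 ->]] := ord_max_or_lift h3.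
      by rewrite ltnNge -ltnS ltn_ord.
    have [->|[g2 ->]] := ord_max_or_lift h2.
      by move=> _; rewrite ltnNge -ltnS ltn_ord.
    have [->|[g1 ->]] := ord_max_or_lift h1; rewrite ?y1l ?y2l ?y1m ?y2m /= ?bE.
      move=> g32 _; rewrite ltn_bump bump_ltnS // ltn_bumpr //.
      exact: cx.
    have cx1 := leq_trans ck (kx g1).
    rewrite [bump c _ < bump c _]ltnNge leq_bump2 -ltnNge.
    by rewrite bump_ltnS // ltn_bumpr //; apply: xP.
have ck : c <= k by have := yi ord_max; rewrite y1m y2m ltnS.
have kx h : k <= x.1 h.
  have := ym (lift ord_max h) ord_max; rewrite y1l y1m /= bE ltnS; apply.
  exact: ltnW.
have cx1 h := leq_trans ck (kx h).
split=> //.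
- split.
  + by move=> h; have := ys (lift ord_max h); rewrite y1l /= bE addSn ltnS.
  + move=> h h' hh; have := ym (lift ord_max h) (lift ord_max h').
    by rewrite !y1l /= !bE ltnS; apply.
  + by move=> h; have := yi (lift ord_max h); rewrite y1l y2l bump_ltnS.
  + move=> h1 h2 h3 g32 g21.
    have := yP (lift ord_max h1) (lift ord_max h2) (lift ord_max h3).
    rewrite /= !bE !y2l y1l => /(_ g32 g21).
    rewrite [bump c _ < bump c _]ltnNge leq_bump2 -ltnNge.
    by rewrite bump_ltnS // ltn_bumpr //.
- move=> h2 h3 g32.
  have := yP ord_max (lift ord_max h2) (lift ord_max h3).
  rewrite /= !bE !y2l y1m y2m => /(_ g32 (ltn_ord _)).
  by rewrite ltn_bump bump_ltnS // ltn_bumpr //.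
Qed.

Lemma lift_max_val n (h : 'I_n) : lift ord_max h = h :> nat.
Proof. by rewrite /= /bump leqNgt ltn_ord. Qed.

Lemma lowest_lift_gt n i (c : 'I_n.+1) (s : 'S_n) :
  i < c -> lowest i (lift_perm ord_max c s) <-> lowest i s.
Proof.
move=> ic; have bi a : (bump c a < i) = (a < i) by rewrite /bump; lia.
have ei a : bump c a = i <-> a = i by rewrite /bump; lia.
split=> low h h'.
  have := low (lift ord_max h) (lift ord_max h').
  by rewrite !lift_perm_lift !lift_max_val /= bi ei.
have [->|[g ->]] := ord_max_or_lift h; first by rewrite lift_perm_id; lia.
have [->|[g' ->]] := ord_max_or_lift h'; first by rewrite lift_perm_id; lia.
by rewrite !lift_perm_lift !lift_max_val /= bi ei; apply: low.
Qed.

Lemma lowest_lift_lt n i (c : 'I_n.+1) (s : 'S_n) :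
  c <= i -> lowest i.+1 (lift_perm ord_max c s) <-> lowest i s.
Proof.
move=> ci; have bi a : (bump c a < i.+1) = (a < i) by rewrite bump_ltnS.
have ei a : bump c a = i.+1 <-> a = i by rewrite /bump; lia.
split=> low h h'.
  have := low (lift ord_max h) (lift ord_max h').
  by rewrite !lift_perm_lift !lift_max_val /= bi ei.
have [->|[g' ->]] := ord_max_or_lift h'; first by rewrite lift_perm_id; lia.
have [->|[g ->]] := ord_max_or_lift h; first by rewrite lift_max_val /= ltn_ord.
by rewrite !lift_perm_lift !lift_max_val /= bi ei; apply: low.
Qed.

(** The 1 of the top row cannot be lower than the 1 of column [0]. *)
Lemma lowest_lift_eq n (c : 'I_n.+1) (s : 'S_n) :
  0 < c -> ~ lowest c (lift_perm ord_max c s).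
Proof.
move=> c_gt0 low; set h := (lift_perm ord_max c s)^-1%g ord0.
have := low h ord_max; rewrite permKV lift_perm_id => /(_ c_gt0 erefl).
by rewrite ltnNge -ltnS ltn_ord.
Qed.

(** * Recurrences for the number of configurations *)

Definition extensions n i (k c : 'I_n.+1) : {set config n} :=
  [set x | `[< avoiding (add_row k c x) /\ lowest i (add_row k c x).2 >]].

Lemma column_one n (s : 'S_n) a : a < n -> exists h, s h = a :> nat.
Proof. by move=> an; exists (s^-1%g (Ordinal an)); rewrite permKV. Qed.

(** Of the columns from [c] to [k.-1], each must carry a 1 lower than all the
others before [k]; so there is at most one such column. *)
Lemma add_row_tail n (k c : 'I_n.+1) (s : 'S_n) : c < k ->
  (forall h2 h3 : 'I_n, h3 < h2 -> c <= s h2 -> s h2 < k -> k <= s h3) <->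
  c.+1 = k /\ lowest c s.
Proof.
have kn := ltn_ord k; move=> ck; split=> [tail|[<- low] h2 h3 h32 ch2 h2k].
  have ck1 : c.+1 = k.
    apply/eqP; rewrite eqn_leq ck leqNgt; apply/negP => ck2.
    have [|h sh] := @column_one _ s c; first by lia.
    have [|h' sh'] := @column_one _ s c.+1; first by lia.
    have [hh|hh|hh] := ltngtP h h'.
    - by have := tail _ _ hh; rewrite sh sh'; lia.
    - by have := tail _ _ hh; rewrite sh sh'; lia.
    by have := val_inj hh => hE; rewrite hE sh' in sh; lia.
  split=> // h h' sh sh'; rewrite ltnNge leq_eqVlt; apply/norP; split.
    by apply/eqP => /val_inj hE; rewrite hE sh' ltnn in sh.
  by apply/negP => hh; have := tail _ _ hh; rewrite sh'; lia.
rewrite leqNgt; apply/negP => h3c.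
have sh2 : s h2 = c :> nat by lia.
have h3neq : s h3 != c :> nat.
  by rewrite -sh2 val_eqE (inj_eq perm_inj) -val_eqE /= ltn_eqF.
by have := low h3 h2; lia.
Qed.

Lemma extensions_top n i (k : 'I_n.+1) :
  extensions i k k = [set x : config n | `[< [/\ avoiding x, wide k x &
    lowest i (lift_perm ord_max k x.2)] >]].
Proof.
apply/setP => x; rewrite !inE; apply: asbool_equiv_eq.
rewrite add_row_avoiding; split=> [[[_ ? ? _] ?] //|[? ? ?]]; split=> //.
by split=> // h2 h3 _; lia.
Qed.

Lemma extensions_below n i (k c : 'I_n.+1) : c < k ->
  extensions i k c = [set x : config n | `[< [/\ c.+1 = k, avoiding x, wide k x,
    lowest c x.2 & lowest i (lift_perm ord_max c x.2)] >]].
Proof.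
move=> ck; apply/setP => x; rewrite !inE; apply: asbool_equiv_eq.
rewrite add_row_avoiding; split=> [[[_ ? ? /(add_row_tail _ ck)[? ?]] ?] //|].
by case=> *; split=> //; split=> //; [apply: ltnW | apply/(add_row_tail _ ck)].
Qed.

Lemma extensions_above n i (k c : 'I_n.+1) : k < c -> extensions i k c = set0.
Proof.
move=> kc; apply/setP => x; rewrite !inE; apply: asboolF.
by rewrite add_row_avoiding => -[[]]; lia.
Qed.

(** Rows get longer downwards, so a configuration that is [k.+1]-wide but not
[k.+2]-wide has a top row of exactly [k.+1] cells. *)
Lemma card_configs_split n i (k : 'I_n.+1) :
  #|configs n.+1 i k.+1| =
    #|configs n.+1 i k.+2| + \sum_(c < n.+1) #|extensions i k c|.
Proof.
have sub : configs n.+1 i k.+2 \subset configs n.+1 i k.+1.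
  apply/subsetP => y; rewrite !inE => /asboolP[ya [kn kr] yl]; apply/asboolP.
  by split=> //; split=> [|h]; rewrite ltnW.
rewrite -(cardsID (configs n.+1 i k.+2)) (setIidPr sub); congr addn.
rewrite -sum1_card.
rewrite (partition_big (fun y : config n.+1 => y.2 ord_max) xpredT) //=.
apply: eq_bigr => c _; rewrite -(card_imset _ (@add_row_inj n k c)) -sum1_card.
apply: eq_bigl => y; apply/idP/imsetP => [|[x]].
  rewrite !inE => /andP[/andP[yN /asboolP[ya [_ yk] yl]] /eqP yc].
  have ymax : y.1 ord_max = k.+1 :> nat.
    apply/eqP; rewrite eqn_leq yk leqNgt andbT; apply: contra yN => kmax.
    apply/asboolP; split=> //; split=> [|h].
      by apply: leq_trans kmax _; rewrite -ltnS ltn_ord.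
    by rewrite (leq_trans kmax) // (avoiding_mono ya) // -ltnS ltn_ord.
  have [x yE] : exists x, y = add_row k (y.2 ord_max) x.
    by apply: add_row_onto => // h; rewrite (leq_trans _ (yk h)).
  by exists x; rewrite -yc // inE; apply/asboolP; rewrite -yE.
rewrite inE => /asboolP[ya yl] yE; rewrite !inE yE add_row2_max eqxx andbT.
apply/andP; split.
  apply/asboolP => -[_ [_ /(_ ord_max) kmax] _]; move: kmax.
  by rewrite add_row1_max ltnn.
apply/asboolP; split=> //; split; first exact: ltn_ord.
move=> h; rewrite -(add_row1_max k c x) (avoiding_mono ya) // -ltnS.
exact: ltn_ord.
Qed.

Lemma configs_gt n i k : n < k -> configs n i k = set0.
Proof.
move=> nk; apply/setP => x; rewrite !inE; apply: asboolF => -[_ []].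
by rewrite leqNgt nk.
Qed.

Lemma card_configs00 : #|configs 0 0 0| = 1.
Proof.
rewrite (_ : configs 0 0 0 = [set: config 0]).
  by rewrite cardsT card_prod card_ffun card_Sn !card_ord.
apply/setP => x; rewrite !inE; apply: asboolT.
split; last by case.
  by split=> [[]|[]|[]|[]].
by split=> // -[].
Qed.

Lemma card_configs0S n : #|configs n.+1 0 0| = #|configs n.+1 0 1|.
Proof.
apply: eq_card => x; rewrite !inE; apply: asbool_equiv_eq.
split=> -[xa [_ x0] _]; split=> //; split=> // h.
by rewrite (leq_trans _ (avoiding_in xa h)).
Qed.

(** A 1 in the last cell of the top row leaves no constraint behind; a 1 in the
cell before it forces the remaining last column to be lowest. *)
Lemma card_configs_free n k :
  #|configs n.+1 0 k.+1| =
    #|configs n.+1 0 k.+2| + #|configs n 0 k|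
    + (if k is k'.+1 then #|configs n k' k| else 0).
Proof.
have [nk|kn] := ltnP n k.
  by case: k nk => // k nk; rewrite !configs_gt ?cards0 // ltnW.
have kn1 : k < n.+1 by [].
rewrite (@card_configs_split _ _ (Ordinal kn1)) -addnA; congr addn.
rewrite (bigD1 (Ordinal kn1)) //=; congr addn.
  rewrite extensions_top; apply: eq_card => x; rewrite !inE.
  by apply: asbool_equiv_eq; split=> -[? ? _]; split.
case: k kn kn1 => [|k] kn kn1.
  rewrite big1 // => c cN; rewrite extensions_above ?cards0 //=.
  by rewrite lt0n.
have kn2 : k < n.+1 by exact: ltnW.
rewrite (bigD1 (Ordinal kn2)) /=; last by rewrite -val_eqE /= ltn_eqF.
rewrite big1 ?addn0 => [|c /andP[]].
  rewrite extensions_below //; apply: eq_card => x; rewrite !inE.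
  by apply: asbool_equiv_eq; split=> [[]|[]].
rewrite -!val_eqE /= neq_ltn => /orP[ck|ck] ckN; last first.
  by rewrite extensions_above ?cards0.
rewrite extensions_below //; apply: eq_card0 => x; rewrite !inE; apply: asboolF.
by case=> /= -[] /eqP; rewrite (negbTE ckN).
Qed.

(** The lowest column [i.+1] is not the last one of the top row.  A top 1
just before the last cell would be in column [i.+1], although it is the highest
one, or would make the last column lowest as well; then columns [0], [i.+1] and
the last one would carry the pattern 321. *)
Lemma card_configs_above n i k : i.+1 < k ->
  #|configs n.+1 i.+1 k.+1| = #|configs n.+1 i.+1 k.+2| + #|configs n i.+1 k|.
Proof.
move=> ik; have [nk|kn] := ltnP n k.
  by rewrite !configs_gt ?cards0 // ltnW.
have kn1 : k < n.+1 by [].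
rewrite (@card_configs_split _ _ (Ordinal kn1)); congr addn.
rewrite (bigD1 (Ordinal kn1)) //= big1 ?addn0 => [|c].
  rewrite extensions_top; apply: eq_card => x; rewrite !inE.
  apply: asbool_equiv_eq.
  by split=> -[? ? /lowest_lift_gt low]; split=> //; [apply: low | apply/low].
rewrite -val_eqE /= neq_ltn => /orP[ck|ck]; last first.
  by rewrite extensions_above ?cards0.
rewrite extensions_below //; apply: eq_card0 => x; rewrite !inE; apply: asboolF.
case=> /= ck1 xa [_ xk] lowc.
have [ic|ci] := ltnP i.+1 c; last first.
  have <- : c = i.+1 :> nat by lia.
  by apply: lowest_lift_eq; lia.
move=> /(lowest_lift_gt _ ic) lowi.
have [|h1 s1] := @column_one _ x.2 0; first by lia.
have [|h2 s2] := @column_one _ x.2 i.+1; first by lia.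
have [|h3 s3] := @column_one _ x.2 c; first by lia.
have h21 : h2 < h1 by apply: lowi; rewrite ?s1.
have h32 : h3 < h2 by apply: lowc; rewrite ?s2.
have := avoiding_P xa h32 h21; have := xk h1.
by rewrite s1 s2 s3; lia.
Qed.

(** The top row ends with the lowest column, which cannot hold the top 1.  So
this 1 is in the cell before, and its removal moves the lowest column one step
to the left. *)
Lemma card_configs_at n i :
  #|configs n.+1 i.+1 i.+2| = #|configs n.+1 i.+1 i.+3| + #|configs n i i.+1|.
Proof.
have [nk|kn] := ltnP n i.+1.
  by rewrite !configs_gt ?cards0 // ltnW.
have kn1 : i.+1 < n.+1 by [].
rewrite (@card_configs_split _ _ (Ordinal kn1)); congr addn.
have kn2 : i < n.+1 by exact: ltnW.
rewrite (bigD1 (Ordinal kn2)) //= big1 ?addn0 => [|c].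
  rewrite extensions_below //; apply: eq_card => x; rewrite !inE.
  apply: asbool_equiv_eq; split=> [[]|[xa xk low]] //; split=> //.
  exact/lowest_lift_lt.
rewrite -val_eqE /= => ci; have [ic|ic|ic] := ltngtP (val c) i.+1.
- rewrite extensions_below //; apply: eq_card0 => x; rewrite !inE.
  apply: asboolF.
  by case=> /= -[] /eqP; rewrite (negbTE ci).
- by rewrite extensions_above ?cards0.
have -> : Ordinal kn1 = c by exact: val_inj.
rewrite extensions_top; apply: eq_card0 => x; rewrite !inE.
apply: asboolF => -[_ _].
by rewrite -ic; apply: lowest_lift_eq; rewrite /= ic.
Qed.

(** * Boards and transversals as configurations *)

Definition board_of n (r : {ffun 'I_n -> 'I_n.+1}) : {set cell n} :=
  [set p : cell n | p.1 < r p.2].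

Definition ones_of n (s : 'S_n) : {set cell n} :=
  [set p : cell n | s p.2 == p.1].

Definition placement n (x : config n) : {set cell n} * {set cell n} :=
  (ones_of x.2, board_of x.1).

Lemma card_ord_lt n k : k <= n -> #|[set c : 'I_n | c < k]| = k.
Proof.
move=> kn; have w_inj : injective (widen_ord kn).
  by move=> i j /(congr1 val) /= /val_inj.
rewrite -[RHS]card_ord -cardsT -(card_imset _ w_inj); apply: eq_card => c.
rewrite inE; apply/idP/imsetP => [ck|[i _ ->]]; last exact: (ltn_ord i).
by exists (Ordinal ck) => //; apply: val_inj.
Qed.

Lemma row_length_board_of n (r : {ffun 'I_n -> 'I_n.+1}) h :
  row_length (board_of r) h = r h.
Proof.
rewrite -[RHS](@card_ord_lt n) -1?ltnS //; apply: eq_card => c.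
by rewrite !inE.
Qed.

Lemma placement_inj n : injective (@placement n).
Proof.
move=> [r s] [r' s'] [/= /setP ss' rr']; congr pair.
  by apply/ffunP => h; apply: val_inj; rewrite /= -!row_length_board_of rr'.
by apply/permP => h; have := ss' (s h, h); rewrite !inE eqxx => /esym/eqP.
Qed.

(** A left-justified row is determined by its length. *)
Lemma is_boardP n (F : {set cell n}) :
  reflect (exists r : {ffun 'I_n -> 'I_n.+1},
    [/\ F = board_of r, forall h : 'I_n, n <= r h + h
      & forall h h' : 'I_n, h <= h' -> r h' <= r h])
    (is_board F).
Proof.
apply: (iffP and4P) => [[/'forall_'forall_forallP left _ mono stair]|].
  pose r := [ffun h => inord (row_length F h) : 'I_n.+1].
  have rE h : r h = row_length F h :> nat.
    by rewrite ffunE inordK // ltnS /row_length -[X in _ <= X]card_ord max_card.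
  exists r; split=> [|h|h h' hh]; last 2 first.
  - by move/forallP: stair => /(_ h); rewrite rE leq_subLR addnC.
  - rewrite !rE; move/'forall_forallP: mono => /(_ h' h).
    by move/implyP; apply.
  apply/setP => -[c h]; rewrite inE /= rE.
  have sub c' : (c', h) \in F -> [set d : 'I_n | d <= c'] \subset
      [set d : 'I_n | (d, h) \in F].
    move=> cF; apply/subsetP => d; rewrite !inE => dc.
    by move: (left c' d h); rewrite dc cF.
  apply/idP/idP => [cF|].
    have := subset_leq_card (sub _ cF).
    by rewrite (eq_card (B := [set d : 'I_n | d < c.+1])) ?card_ord_lt.
  rewrite ltnNge; apply: contraR => cF.
  rewrite /row_length -[X in _ <= X](card_ord_lt (ltnW (ltn_ord c))).
  apply/subset_leq_card/subsetP => d; rewrite !inE => dF; rewrite ltnNge.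
  by apply: contra cF => cd; have := subsetP (sub _ dF) c; rewrite !inE; apply.
case=> r [-> stair mono]; split.
- apply/'forall_'forall_forallP => c c' h; rewrite !inE /=.
  by apply/implyP => cc; apply/implyP; apply: leq_ltn_trans.
- apply/'forall_'forall_forallP => c h h'; rewrite !inE /=.
  by apply/implyP => hh; apply/implyP => ch; apply: (leq_trans ch); apply: mono.
- apply/'forall_forallP => h h'; rewrite !row_length_board_of.
  by apply/implyP => hh; apply: mono.
- by apply/forallP => h; rewrite row_length_board_of leq_subLR addnC.
Qed.

Lemma is_transversalP n (F T : {set cell n}) :
  reflect (exists2 s : 'S_n, T = ones_of s & forall h, (s h, h) \in F)
    (Defs.is_transversal F T).
Proof.
apply: (iffP and3P) => [[/subsetP TF /forallP cols /forallP rows]|[s -> sF]].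
  have rowP h : exists c, [set c | (c, h) \in T] = [set c].
    exact/cards1P/rows.
  have f_inj : injective (fun h => sval (cid (rowP h))).
    move=> h h' /=; case: (cid _) => c /= /setP/(_ c).
    rewrite !inE eqxx => hc.
    case: (cid _) => c' /= /setP/(_ c'); rewrite !inE eqxx => hc' cc.
    have /cards1P[d /setP colc] := cols c; move: (colc h) (colc h').
    by rewrite !inE hc {1}cc hc' => /esym/eqP -> /esym/eqP ->.
  have TE : T = ones_of (perm f_inj).
    apply/setP => -[c h]; rewrite inE /= permE.
    case: (cid _) => d /= /setP/(_ c).
    by rewrite !inE eq_sym.
  by move: (perm f_inj) TE => s TE; exists s => // h; apply: TF; rewrite TE inE.
split.
- by apply/subsetP => -[c h]; rewrite inE /= => /eqP <-.
- apply/forallP => c; apply/cards1P; exists (s^-1%g c); apply/setP => h.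
  by rewrite !inE /= -[RHS](inj_eq (@perm_inj _ s)) permKV.
- apply/forallP => h; apply/cards1P; exists (s h); apply/setP => c.
  by rewrite !inE eq_sym.
Qed.

Lemma containsI n (F T : {set cell n}) (p : seq nat) (c h : nat -> 'I_n) :
  (forall i j, i < j < size p -> c i < c j) ->
  (forall i, i < size p -> (c i, h i) \in T) ->
  (forall i j, i < size p -> j < size p ->
     (h i < h j) = (nth 0 p i < nth 0 p j)) ->
  (forall i j, i < size p -> j < size p -> (c i, h j) \in F) ->
  contains F T p.
Proof.
move=> cP TP hP FP; apply/existsP; exists [ffun i : 'I__ => c i].
apply/existsP; exists [ffun i : 'I__ => h i]; apply/and4P; split.
- apply/'forall_forallP => i j; rewrite !ffunE; apply/implyP => ij.
  by apply: cP; rewrite ij /=.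
- by apply/forallP => i; rewrite !ffunE; apply: TP.
- by apply/'forall_forallP => i j; rewrite !ffunE hP.
- by apply/'forall_forallP => i j; rewrite !ffunE; apply: FP.
Qed.

Lemma containsE n (F T : {set cell n}) (p : seq nat) : contains F T p ->
  exists c h : 'I_(size p) -> 'I_n,
  [/\ forall i j : 'I_(size p), i < j -> c i < c j,
      forall i, (c i, h i) \in T,
      forall i j, (h i < h j) = (nth 0 p i < nth 0 p j)
    & forall i j, (c i, h j) \in F].
Proof.
move=> /existsP[c /existsP[h /and4P[cP TP hP FP]]]; exists c, h; split.
- by move=> i j; move/'forall_forallP: cP => /(_ i j)/implyP.
- exact/forallP.
- by move=> i j; move/'forall_forallP: hP => /(_ i j)/eqP.
- by move=> i j; move/'forall_forallP: FP => /(_ i j).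
Qed.

(** In a forbidden triple, the column of [h1] is to the left of that of [h2].
The column of [h3] comes before, between or after them, which gives 132, 312
and 321 respectively. *)
Lemma avoids_P16 n (x : config n) :
  (forall h h' : 'I_n, h <= h' -> x.1 h' <= x.1 h) ->
  all (fun p => ~~ contains (board_of x.1) (ones_of x.2) p) P16 <->
  (forall h1 h2 h3 : 'I_n, h3 < h2 -> h2 < h1 ->
    x.2 h1 < x.2 h2 -> x.2 h2 < x.1 h1 -> x.1 h1 <= x.2 h3).
Proof.
case: x => r s /= mono; split=> [|avoid]; last first.
  pose i0 : 'I_3 := inord 0; pose i1 : 'I_3 := inord 1.
  pose i2 : 'I_3 := inord 2.
  have i01 : i0 < i1 by rewrite !inordK.
  have i12 : i1 < i2 by rewrite !inordK.
  rewrite andbT; apply/and3P; split.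
  1-3: apply/negP => /containsE[c [h]] /= [cP TP hP FP].
  1-3: have := TP i0; have := TP i1; have := TP i2; rewrite !inE /=.
  1-3: move=> /eqP s2 /eqP s1 /eqP s0; have := cP _ _ i01; have := cP _ _ i12.
  - have := avoid (h i1) (h i2) (h i0); have := FP i2 i1; have := FP i0 i1.
    by rewrite !hP !inE /= !inordK //= s0 s1 s2 => ? ? /(_ isT isT); lia.
  - have := avoid (h i0) (h i2) (h i1); have := FP i2 i0; have := FP i1 i0.
    by rewrite !hP !inE /= !inordK //= s0 s1 s2 => ? ? /(_ isT isT); lia.
  - have := avoid (h i0) (h i1) (h i2); have := FP i1 i0; have := FP i2 i0.
    by rewrite !hP !inE /= !inordK //= s0 s1 s2 => ? ? /(_ isT isT); lia.
rewrite andbT => /and3P[n132 n312 n321] h1 h2 h3 h32 h21 s12 s2r.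
rewrite leqNgt; apply/negP => s3r.
have r12 := mono _ _ (ltnW h21); have r23 := mono _ _ (ltnW h32).
have s32 : s h3 <> s h2 :> nat.
  by move=> /val_inj/perm_inj hE; rewrite hE ltnn in h32.
have s31 : s h3 <> s h1 :> nat.
  by move=> /val_inj/perm_inj hE; rewrite hE in h32; lia.
have [s3s1|s1s3] := ltnP (s h3) (s h1).
  move/negP: n132; apply; pose hs := [:: h3; h1; h2].
  apply: (containsI (c := fun i => s (nth h1 hs i)) (h := nth h1 hs)).
  - by move=> [|[|[|i]]] [|[|[|j]]] //= *; lia.
  - by move=> [|[|[|i]]] //= _; rewrite inE.
  - by move=> [|[|[|i]]] [|[|[|j]]] //= *; lia.
  - by move=> [|[|[|i]]] [|[|[|j]]] //= _ _; rewrite inE /=; lia.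
have [s3s2|s2s3] := ltnP (s h3) (s h2).
  move/negP: n312; apply; pose hs := [:: h1; h3; h2].
  apply: (containsI (c := fun i => s (nth h1 hs i)) (h := nth h1 hs)).
  - by move=> [|[|[|i]]] [|[|[|j]]] //= *; lia.
  - by move=> [|[|[|i]]] //= _; rewrite inE.
  - by move=> [|[|[|i]]] [|[|[|j]]] //= *; lia.
  - by move=> [|[|[|i]]] [|[|[|j]]] //= _ _; rewrite inE /=; lia.
move/negP: n321; apply; pose hs := [:: h1; h2; h3].
apply: (containsI (c := fun i => s (nth h1 hs i)) (h := nth h1 hs)).
- by move=> [|[|[|i]]] [|[|[|j]]] //= *; lia.
- by move=> [|[|[|i]]] //= _; rewrite inE.
- by move=> [|[|[|i]]] [|[|[|j]]] //= *; lia.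
- by move=> [|[|[|i]]] [|[|[|j]]] //= _ _; rewrite inE /=; lia.
Qed.

Lemma card_avoiders n : #|avoiders n P16| = #|configs n 0 0|.
Proof.
rewrite -(card_imset _ (@placement_inj n)); apply: eq_card => -[T F].
apply/idP/imsetP => [|[x]]; rewrite inE.
  move=> /and3P[/is_boardP[r [/= -> stair mono]] /is_transversalP[s -> sF] av].
  exists (r, s) => //; rewrite inE; apply/asboolP; split=> //.
  split=> //= [h|]; first by have := sF h; rewrite inE.
  by have [+ _] := @avoids_P16 n (r, s) mono; apply.
move=> /asboolP[[stair mono xin xP] _ _] [-> ->]; rewrite inE.
apply/and3P; split=> /=.
- by apply/is_boardP; exists x.1.
- by apply/is_transversalP; exists x.2 => // h; rewrite inE; apply: xin.
- exact/avoids_P16.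
Qed.

(** * Power series and the kernel method *)

Local Open Scope ring_scope.

Lemma fpsXM0 (f : fps) : (fpsX * f) 0%N = 0.
Proof. by rewrite fpsM0E mul0r. Qed.

Lemma fpsXMS (f : fps) n : (fpsX * f) n.+1 = f n.
Proof.
rewrite fpsME big_ord_recl big_ord_recl /= mul0r add0r mul1r subSS subn0.
by rewrite big1 ?addr0 // => i _; rewrite mul0r.
Qed.

Lemma fpsM_low (f g : fps) m :
  (forall n, (n < m)%N -> f n = 0) -> forall n, (n < m)%N -> (f * g) n = 0.
Proof.
move=> f0 n nm; rewrite fpsME big1 // => i _.
by rewrite f0 ?mul0r // (leq_ltn_trans _ nm) // -ltnS.
Qed.

Definition sqrt1B4X : fps := fps_sqrt (1 - 4 * fpsX).
(** The power series solution of [t * (1 - t) = X], that is, [X] times the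
generating series of the Catalan numbers. *)
Definition catalan_root : fps := (1 - sqrt1B4X) / 2.

Lemma fps_nat_unit k : (k.+1%:R : fps) \is a GRing.unit.
Proof. by rewrite fps_unitE fpsMnE fps1E /= pnatr_eq0. Qed.

Lemma sqrt1B4XE : sqrt1B4X = 1 - 2 * catalan_root.
Proof. by rewrite /catalan_root mulrC divrK ?fps_nat_unit // subKr. Qed.

Lemma catalan_rootM1B : catalan_root * (1 - catalan_root) = fpsX.
Proof.
have : sqrt1B4X ^+ 2 = 1 - 4 * fpsX.
  by rewrite fps_sqrtK // fpsDE fpsNE mulrC fpsXM0 subr0.
rewrite sqrt1B4XE => sq; apply: (mulrI (fps_nat_unit 3)).
have -> : 4 * fpsX = 1 - (1 - 2 * catalan_root) ^+ 2 by rewrite sq; ring.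
by ring.
Qed.

Lemma catalan_root0 : catalan_root 0%N = 0.
Proof. by rewrite fpsM0E fpsDE fpsNE fps_sqrt0 subrr mul0r. Qed.

Lemma catalan_rootX_low m n : (n < m)%N -> (catalan_root ^+ m) n = 0.
Proof.
elim: m n => // m IHm n nm; rewrite exprS fpsME big1 // => i _.
case: (posnP i) => [->|i_gt0]; first by rewrite catalan_root0 mul0r.
by rewrite IHm ?mulr0 //; have := ltn_ord i; lia.
Qed.

Lemma compl_catalan_root_unit : 1 - catalan_root \is a GRing.unit.
Proof. by rewrite fps_unitE fpsDE fpsNE catalan_root0 subr0 oner_eq0. Qed.

Lemma sqrt1B4X_unit : sqrt1B4X \is a GRing.unit.
Proof. by rewrite fps_unitE fps_sqrt0 oner_eq0. Qed.

(** [E 0] is [u^-m * E m], hence divisible by every power of [X]. *)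
Lemma geometric_low (E : nat -> fps) u : u \is a GRing.unit ->
  (forall m, E m.+1 = u * E m) -> (forall m n, (n < m)%N -> E m n = 0) ->
  E 0%N = 0.
Proof.
move=> uU Erec Elow; have EX m : E m = u ^+ m * E 0%N.
  by elim: m => [|m IHm]; rewrite ?mul1r // Erec IHm exprS mulrA.
apply/fpsP => n; rewrite -(mulKr (unitrX n.+1 uU) (E 0%N)) -EX mulrC.
by rewrite (fpsM_low _ (Elow n.+1)).
Qed.

(** Since [U m] is [O(X^m)], the solution of the recurrence has no component on
the root [1 - catalan_root] of the characteristic equation.  The forcing term
is resonant with the other root; the particular solution is
[m * catalan_root^m * V] up to a constant, whence the factor [sqrt1B4X], the
difference of the two roots. *)
Lemma kernel_method (U : nat -> fps) (V : fps) :
  (forall m, U m.+1 = U m.+2 + fpsX * (U m + catalan_root ^+ m * V)) ->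
  (forall m n, (n < m)%N -> U m n = 0) ->
  sqrt1B4X * (U 1%N - catalan_root * U 0%N) = fpsX * V.
Proof.
move=> Urec Ulow; apply/eqP; rewrite -subr_eq0; apply/eqP.
(* [U m.+1 - catalan_root * U m] kills the powers of [catalan_root]; its value
   on the particular solution is subtracted, so that what is left in [E] is
   geometric of ratio [1 - catalan_root]. *)
pose E m :=
  sqrt1B4X * (U m.+1 - catalan_root * U m) - catalan_root ^+ m * (fpsX * V).
have -> : sqrt1B4X * (U 1%N - catalan_root * U 0%N) - fpsX * V = E 0%N.
  by rewrite /E expr0 mul1r.
apply: (geometric_low compl_catalan_root_unit) => [m|m n nm].
  have -> : E m.+1 = sqrt1B4X * (U m.+2 - catalan_root * U m.+1)
                     - catalan_root ^+ m.+1 * (fpsX * V) by [].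
  have -> : U m.+2 = U m.+1 - fpsX * (U m + catalan_root ^+ m * V).
    by rewrite [U m.+1]Urec addrK.
  by rewrite /E sqrt1B4XE -catalan_rootM1B exprS; ring.
rewrite /E fpsDE fpsNE (fpsM_low _ (@catalan_rootX_low m)) // subr0 mulrC.
rewrite (@fpsM_low _ _ m) // => k km.
by rewrite fpsDE fpsNE mulrC (fpsM_low _ (Ulow m)) // Ulow ?subr0 // ltnW.
Qed.

(** * Series of configurations *)

Definition configs_series i k : fps := gen_series (fun n => #|configs n i k|).

Lemma configs_series_low i k n : (n < k)%N -> configs_series i k n = 0.
Proof. by move=> nk; rewrite /= configs_gt ?cards0. Qed.

Lemma configs_series_init :
  configs_series 0 0 = 1 + configs_series 0 1.
Proof.
apply/fpsP => -[|n]; rewrite fpsDE fps1E /=.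
  by rewrite card_configs00 configs_gt ?cards0 ?addr0.
by rewrite card_configs0S add0r.
Qed.

Lemma fps_step (f g h : fps) : f 0%N = 0 -> g 0%N = 0 ->
  (forall n, f n.+1 = g n.+1 + h n) -> f = g + fpsX * h.
Proof.
move=> f0 g0 fgh; apply/fpsP => -[|n]; rewrite fpsDE.
  by rewrite fpsXM0 f0 g0 addr0.
by rewrite fpsXMS fgh.
Qed.

Lemma configs_series_free0 :
  configs_series 0 1 = configs_series 0 2 + fpsX * configs_series 0 0.
Proof.
apply: fps_step => [||n]; try exact: configs_series_low.
by rewrite /= card_configs_free addn0 natrD.
Qed.

Lemma configs_series_free k :
  configs_series 0 k.+2 = configs_series 0 k.+3
    + fpsX * (configs_series 0 k.+1 + configs_series k k.+1).
Proof.
apply: fps_step => [||n]; try exact: configs_series_low.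
by rewrite /= card_configs_free !natrD addrA.
Qed.

Lemma configs_series_above i k : (i.+1 < k)%N ->
  configs_series i.+1 k.+1 =
    configs_series i.+1 k.+2 + fpsX * configs_series i.+1 k.
Proof.
move=> ik; apply: fps_step => [||n]; try exact: configs_series_low.
by rewrite /= card_configs_above // natrD.
Qed.

Lemma configs_series_at i :
  configs_series i.+1 i.+2 =
    configs_series i.+1 i.+3 + fpsX * configs_series i i.+1.
Proof.
apply: fps_step => [||n]; try exact: configs_series_low.
by rewrite /= card_configs_at natrD.
Qed.

(** Moving the lowest column one step to the left costs a factor
[catalan_root]: apply [kernel_method] without forcing term. *)
Lemma configs_series_special i :
  configs_series i i.+1 = catalan_root ^+ i * configs_series 0 1.
Proof.
elim: i => [|i IHi]; first by rewrite mul1r.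
rewrite exprS -mulrA -IHi; apply/eqP; rewrite -subr_eq0; apply/eqP.
(* At [m = 0] the recurrence leaves the family of index [i.+1], because
   [configs_series_at] refers to the preceding one. *)
pose U m := configs_series (if m is 0 then i else i.+1) (i.+1 + m).
have := @kernel_method U 0; rewrite mulr0 /U !addn0 addn1 => K.
apply: (mulrI sqrt1B4X_unit); rewrite mulr0; apply: K => [[|m]|m n nm].
- by rewrite mulr0 addr0 addn1 addn2 addn0 configs_series_at.
- rewrite mulr0 addr0 !addnS configs_series_above //.
  by rewrite ltnS addSn ltnS leq_addr.
- by rewrite configs_series_low // ltn_addl.
Qed.

Theorem theorem29 :
  gen_series (fun n : nat => #|avoiders n P16|) =
    (3 * fps_sqrt (1 - 4 * fpsX) - 1) /
    (2 * fps_sqrt (1 - 4 * fpsX) - 4 * fpsX).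
Proof.
rewrite (_ : gen_series _ = configs_series 0 0); last first.
  by apply/fpsP => n /=; rewrite card_avoiders.
have free2 : sqrt1B4X * (configs_series 0 2 - catalan_root * configs_series 0 1)
             = fpsX * configs_series 0 1.
  apply: (@kernel_method (fun m => configs_series 0 m.+1)) => [m|m n nm].
    by rewrite configs_series_free configs_series_special.
  by rewrite configs_series_low // ltnW.
have free1 := configs_series_free0; have free0 := configs_series_init.
have X0 : fpsX 0%N = 0 by [].
rewrite -/sqrt1B4X; apply/esym/(canLR (mulrK _)).
  rewrite fps_unitE fpsDE fpsNE !fpsM0E X0 mulr0 subr0 fps_sqrt0 mulr1.
  exact: (fps_nat_unit 1).
move: free2 free1 free0; set A := configs_series 0 0.
move: (configs_series 0 1) (configs_series 0 2) => H1 H2 free2 free1 free0.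
have H1E : H1 = A - 1 by rewrite free0 addrAC subrr add0r.
have H2E : H2 = H1 - fpsX * A by rewrite free1 addrK.
apply/esym/eqP; rewrite -subr_eq0; apply/eqP.
apply: (mulrI compl_catalan_root_unit).
(* Up to the factor [1 - catalan_root], twice the linear relation [free2] is
   the claim. *)
move: free2; rewrite H2E H1E sqrt1B4XE -catalan_rootM1B => /eqP.
rewrite -subr_eq0 => /eqP free2.
transitivity (2 * 0 : fps); last by rewrite !mulr0.
by rewrite -free2; ring.
Qed.
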